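(* Let $P,K:\mathbb{N}_0\to\mathbb{N}_0$ be a scaling for which the limit $q^\star=\lim_{n\to\infty}q(\theta_n)$ exists. Then $\lim_{n\to\infty}\mathbb{P}[T_n(\theta_n)>0]=1$ holds if either $0\le q^\star<1$, or $q^\star=1$ and $\lim_{n\to\infty}n^3\tau(\theta_n)=\infty$.
   Context: Random key graph: for positive integers $K\le P$, $\theta=(K,P)$ and $n\ge3$, let $K_1(\theta),\dots,K_n(\theta)$ be i.i.d. random subsets of $\{1,\dots,P\}$, each uniform over the $K$-element subsets; the random key graph $\mathbb{K}(n;\theta)$ on $\{1,\dots,n\}$ has an edge between distinct $i,j$ iff $K_i(\theta)\cap K_j(\theta)\ne\emptyset$. $T_n(\theta)$ denotes the number of triangles in $\mathbb{K}(n;\theta)$. $q(\theta)=\binom{P-K}{K}/\binom{P}{K}$ if $2K\le P$ and $q(\theta)=0$ if $P<2K$. $\tau(\theta)=K^3/P^2+(K^2/P)^3$. A scaling is a pair of functions $P,K:\mathbb{N}_0\to\mathbb{N}_0$ with $1\le K_n\le P_n$ for all $n$, and $\theta_n=(K_n,P_n)$. *)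

(* Defs.v *)
From Stdlib Require Import Reals.
From mathcomp Require Import all_boot.
Set Implicit Arguments. Unset Strict Implicit. Unset Printing Implicit Defensive.

(* Key pool {1,...,P} is represented by 'I_P; a key ring is a K-subset. *)
Definition keyring (P K : nat) : predArgType :=
  {A : {set 'I_P} | #|A| == K}.

(* An outcome: the key rings K_1(theta),...,K_n(theta) of the n nodes.
   Under the i.i.d. uniform model, the joint law is uniform on this space. *)
Definition outcome (n P K : nat) : predArgType := {ffun 'I_n -> keyring P K}.

Definition rkg_adj (n P K : nat) (w : outcome n P K) (i j : 'I_n) : bool :=
  (i != j) && ~~ [disjoint (val (w i)) & (val (w j))].

Definition triangles (n P K : nat) (w : outcome n P K) : nat :=
  #|[set t : 'I_n * 'I_n * 'I_n |
       [&& (t.1.1 < t.1.2)%N, (t.1.2 < t.2)%N,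
           rkg_adj w t.1.1 t.1.2, rkg_adj w t.1.2 t.2 & rkg_adj w t.1.1 t.2]]|.

Definition prob_triangle (n P K : nat) : R :=
  Rdiv (INR #|[set w : outcome n P K | (0 < triangles w)%N]|)
       (INR #|outcome n P K|).

Definition qtheta (K P : nat) : R :=
  if (2 * K <= P)%N then Rdiv (INR 'C(P - K, K)) (INR 'C(P, K)) else R0.

Definition tautheta (K P : nat) : R :=
  Rplus (Rdiv (pow (INR K) 3) (pow (INR P) 2))
        (pow (Rdiv (pow (INR K) 2) (INR P)) 3).

(* Main.v *)
(* Second moment method on a tripartite count.  Fix three disjoint blocks of
   m = n / 3 vertices and let X count the triangles with one vertex in each block.
   Given one ring, the probability b that two further rings complete a triangle
   does not depend on that ring, so two triples sharing at most one vertex are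
   uncorrelated, and Chebyshev's inequality gives
     Pr[X = 0] <= 1 / (m^3 b) + 3 g / (m^2 b^2),
   where g is the probability that two triangles share a given edge.  With
   q = q(theta), inclusion-exclusion gives b = (1 - q)^3 + q (q^2 - r), where r
   is the probability that a ring avoids two given disjoint rings, and r <= q^2.
   If q stays away from 1, then b >= (1 - q)^3 and g <= b suffice.  Otherwise
   lam = K^2 / P tends to 0, b is at least tau / 16, and g <= 1024 b^2 / lam;
   since tau <= 2 lam^2, n^3 tau -> oo also forces n^2 lam -> oo. *)

Require Import Defs.
From Stdlib Require Import Reals.
From mathcomp Require Import all_boot.
From mathcomp Require Import all_order all_algebra ring lra Rstruct.
Set Implicit Arguments. Unset Strict Implicit. Unset Printing Implicit Defensive.
Import Order.TTheory GRing.Theory Num.Theory.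
Local Open Scope ring_scope.

(** * Uniform averages over finite types: independent copies of coordinates, Chebyshev's
    inequality *)

Section Average.
Variable R : realFieldType.
Implicit Types S T I : finType.

Definition avg T (f : T -> R) : R := (\sum_x f x) / #|T|%:R.

Lemma eq_avg T (f g : T -> R) : f =1 g -> avg f = avg g.
Proof. by move=> fg; rewrite /avg (eq_bigr g). Qed.

Lemma ler_avg T (f g : T -> R) : (forall x, f x <= g x) -> avg f <= avg g.
Proof. by move=> fg; rewrite ler_wpM2r ?invr_ge0 // ler_sum. Qed.

Lemma avg_ge0 T (f : T -> R) : (forall x, 0 <= f x) -> 0 <= avg f.
Proof. by move=> f0; rewrite divr_ge0 // sumr_ge0. Qed.

Lemma avgD T (f g : T -> R) : avg (fun x => f x + g x) = avg f + avg g.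
Proof. by rewrite /avg big_split mulrDl. Qed.

Lemma avgZ T c (f : T -> R) : avg (fun x => c * f x) = c * avg f.
Proof. by rewrite /avg -mulr_sumr mulrA. Qed.

Lemma avgZr T c (f : T -> R) : avg (fun x => f x * c) = avg f * c.
Proof. by rewrite /avg -mulr_suml mulrAC. Qed.

Lemma avgN T (f : T -> R) : avg (fun x => - f x) = - avg f.
Proof. by rewrite /avg sumrN mulNr. Qed.

Lemma avgC T c : (0 < #|T|)%N -> avg (fun _ : T => c) = c.
Proof.
by move=> T0; rewrite /avg sumr_const -[c *+ _]mulr_natr mulfK // pnatr_eq0 -lt0n.
Qed.

Lemma avg_sum T I (V : {set I}) (F : I -> T -> R) :
  avg (fun x => \sum_(i in V) F i x) = \sum_(i in V) avg (F i).
Proof. by rewrite /avg exchange_big mulr_suml. Qed.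

Lemma exchange_avg S T (f : S -> T -> R) :
  avg (fun x => avg (f x)) = avg (fun y => avg (f^~ y)).
Proof. by rewrite /avg -!mulr_suml exchange_big mulrAC. Qed.

Lemma avgM S T (f : S -> R) (g : T -> R) :
  avg (fun x => avg (fun y => f x * g y)) = avg f * avg g.
Proof. by rewrite -avgZr; apply: eq_avg => x; rewrite avgZ. Qed.

Lemma avg_card T (p : pred T) : avg (fun x => (p x)%:R) = #|p|%:R / #|T|%:R.
Proof.
rewrite /avg -sum1_card natr_sum [in RHS]big_mkcond; congr (_ / _).
by apply: eq_bigr => x _; rewrite unfold_in; case: (p x).
Qed.

Definition update I T (w : {ffun I -> T}) i a : {ffun I -> T} :=
  [ffun j => if j == i then a else w j].

Lemma updateE I T (w : {ffun I -> T}) i a j : j != i -> update w i a j = w j.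
Proof. by rewrite ffunE => /negPf->. Qed.

(* The involution [(w, a) |-> (update w i a, w i)] swaps the i-th coordinate with
   an independent copy of it. *)
Lemma avg_resample I T (i : I) (f : T -> {ffun I -> T} -> R) :
  (0 < #|T|)%N -> (forall a w b, f a (update w i b) = f a w) ->
  avg (fun w : {ffun I -> T} => f (w i) w) = avg (fun a => avg (f a)).
Proof.
move=> T0 fi.
have N0 : #|T|%:R != 0 :> R by rewrite pnatr_eq0 -lt0n.
rewrite /avg -[in RHS]mulr_suml mulrAC; congr (_ / _).
apply: (mulIf N0); rewrite mulfVK //.
have -> : (\sum_(w : {ffun I -> T}) f (w i) w) * #|T|%:R =
    \sum_(p : {ffun I -> T} * T) f (p.1 i) p.1.
  rewrite -(pair_bigA _ (fun (w : {ffun I -> T}) (_ : T) => f (w i) w)) mulr_suml.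
  by apply: eq_bigr => w _; rewrite sumr_const mulr_natr.
rewrite exchange_big pair_bigA /=.
have phiK : involutive (fun p : {ffun I -> T} * T => (update p.1 i p.2, p.1 i)).
  move=> [w a] /=; rewrite ffunE eqxx; congr (_, _).
  by apply/ffunP => j; rewrite !ffunE; case: eqP => // ->.
rewrite (reindex_inj (inv_inj phiK)) /=; apply: eq_bigr => -[w a] _ /=.
by rewrite ffunE eqxx fi.
Qed.

(** A diagonal pair involves one value, an off-diagonal pair two independent ones. Since [F] reads
    no coordinate in [V] through its third argument, these values can be replaced by fresh copies
    one after the other. *)
Lemma avg_pairs I T (V : {set I}) (F : T -> T -> {ffun I -> T} -> R) :
  (0 < #|T|)%N ->
  (forall i a b w c, i \in V -> F a b (update w i c) = F a b w) ->
  avg (fun w : {ffun I -> T} => \sum_(i in V) \sum_(j in V) F (w i) (w j) w) =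
  #|V|%:R * avg (fun a => avg (F a a)) +
  (#|V|%:R ^+ 2 - #|V|%:R) * avg (fun a => avg (fun b => avg (F a b))).
Proof.
move=> T0 Fi; rewrite avg_sum.
pose D := avg (fun a => avg (F a a)).
pose O := avg (fun a => avg (fun b => avg (F a b))).
rewrite (eq_bigr (fun _ => D + (#|V|%:R - 1) * O)) => [|i iV].
  by rewrite sumr_const -[LHS]mulr_natr; rewrite /D /O; ring.
rewrite avg_sum (bigD1 i) //=; congr (_ + _).
  by rewrite (avg_resample (i := i) (f := fun a w => F a a w)) // => a w b; apply: Fi.
rewrite (eq_bigr (fun _ => O)) => [|j /andP[jV ji]].
  rewrite sumr_const -[LHS]mulr_natl; congr (_ * _).
  rewrite (cardsD1 i V) iV natrD /= [1 + _]addrC addrK; congr (_%:R).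
  by apply: eq_card => j; rewrite !inE andbC.
rewrite (avg_resample (i := i) (f := fun a w => F a (w j) w)) //; last first.
  by move=> a w b; rewrite Fi // updateE.
apply: eq_avg => a.
by rewrite (avg_resample (i := j) (f := fun b w => F a b w)) // => b w c; apply: Fi.
Qed.

(** Where [X] vanishes, [(X x - mu) ^+ 2] equals [mu ^+ 2]; hence the left integrand is pointwise
    below the one of the variance. *)
Lemma chebyshev0 T (X : T -> R) (mu : R) :
  (0 < #|T|)%N -> avg X = mu ->
  avg (fun x => (X x == 0)%:R) * mu ^+ 2 <= avg (fun x => X x ^+ 2) - mu ^+ 2.
Proof.
move=> T0 EX; rewrite -avgZr.
have -> : avg (fun x => X x ^+ 2) - mu ^+ 2 = avg (fun x => (X x - mu) ^+ 2).
  rewrite [RHS](eq_avg (g := fun x => X x ^+ 2 + ((- 2 * mu) * X x + mu ^+ 2)));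
    last by move=> x; ring.
  by rewrite !avgD avgZ EX avgC //; ring.
apply: ler_avg => x; have [->|_] := eqVneq (X x) 0.
  by rewrite mul1r sub0r sqrrN.
by rewrite mul0r sqr_ge0.
Qed.

End Average.

(** * First and second moments of the tripartite triangle count *)

Section Tripartite.
Variables (R : realFieldType) (I T : finType) (e : rel T).
Hypothesis esym : symmetric e.
Hypothesis T0 : (0 < #|T|)%N.

Definition tri x y z : R := [&& e x y, e y z & e x z]%:R.

Lemma tri_swapl x y z : tri x y z = tri y x z.
Proof. by rewrite /tri (esym x y); do 3 case: (e _ _). Qed.

Lemma tri_swapr x y z : tri x y z = tri x z y.
Proof. by rewrite /tri (esym y z); do 3 case: (e _ _). Qed.

Lemma tri_ge0 x y z : 0 <= tri x y z.
Proof. exact: ler0n. Qed.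

Lemma triM x y z : tri x y z * tri x y z = tri x y z.
Proof. by rewrite /tri; case: [&& _, _ & _]; rewrite ?mulr1 ?mulr0. Qed.

(** Given the pair [x], [y], two fresh vertices complete a triangle on it independently, hence the
    square. *)
Definition shared_edge_prob : R := avg (fun x => avg (fun y => avg (tri x y) ^+ 2)).

Variable beta : R.
Hypothesis regular : forall x, avg (fun y => avg (tri x y)) = beta.

Variables V1 V2 V3 : {set I}.
Hypotheses (d12 : [disjoint V1 & V2]) (d13 : [disjoint V1 & V3])
           (d23 : [disjoint V2 & V3]).
Variable m : nat.
Hypotheses (c1 : #|V1| = m) (c2 : #|V2| = m) (c3 : #|V3| = m).

Definition ntri (w : {ffun I -> T}) : R :=
  \sum_(i in V1) \sum_(j in V2) \sum_(k in V3) tri (w i) (w j) (w k).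

Lemma neq_disjoint (A B : {set I}) i j :
  [disjoint A & B] -> i \in A -> j \in B -> j != i.
Proof.
move=> dAB iA jB; apply/eqP => ji; move: jB.
by rewrite ji (disjointFr dAB iA).
Qed.

Lemma avg_ntri : avg ntri = m%:R ^+ 3 * beta.
Proof.
have W0 : (0 < #|{ffun I -> T}|)%N by rewrite card_ffun expn_gt0 T0.
rewrite /ntri avg_sum (eq_bigr (fun _ => m%:R ^+ 2 * beta)) => [|i iV].
  by rewrite sumr_const c1 -[LHS]mulr_natl; ring.
rewrite avg_sum (eq_bigr (fun _ => m%:R * beta)) => [|j jV].
  by rewrite sumr_const c2 -[LHS]mulr_natl; ring.
rewrite avg_sum (eq_bigr (fun _ => beta)) => [|k kV].
  by rewrite sumr_const c3 -[LHS]mulr_natl.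
have ji := neq_disjoint d12 iV jV; have ki := neq_disjoint d13 iV kV.
have kj := neq_disjoint d23 jV kV.
rewrite (avg_resample (i := i) (f := fun a w => tri a (w j) (w k))) //; last first.
  by move=> a w b; rewrite !updateE.
rewrite (eq_avg (g := fun _ => beta)) ?avgC // => a.
rewrite (avg_resample (i := j) (f := fun b w => tri a b (w k))) //; last first.
  by move=> b w c; rewrite !updateE.
rewrite -[RHS](regular a); apply: eq_avg => b.
rewrite (avg_resample (i := k) (f := fun c w => tri a b c)) //.
by apply: eq_avg => c; rewrite avgC.
Qed.

Lemma sqr_sum (V : {set I}) (f : I -> R) :
  (\sum_(i in V) f i) ^+ 2 = \sum_(i in V) \sum_(j in V) f i * f j.
Proof. by rewrite expr2 mulr_suml; apply: eq_bigr => i _; rewrite mulr_sumr. Qed.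

(** Pairs of triples are sorted by their number of common vertices: three contribute [beta], two
    [shared_edge_prob], and at most one [beta ^+ 2], by regularity. *)
Lemma avg_ntri_sqr :
  avg (fun w => ntri w ^+ 2) <=
  m%:R ^+ 3 * beta + 3 * m%:R ^+ 4 * shared_edge_prob + m%:R ^+ 6 * beta ^+ 2.
Proof.
have W0 : (0 < #|{ffun I -> T}|)%N by rewrite card_ffun expn_gt0 T0.
(* [F1] takes the values at the two [V1] vertices as arguments, [F2] also those at the [V2]
   vertices, so that [avg_pairs] peels off one block at a time. *)
pose F1 a a' (w : {ffun I -> T}) :=
  \sum_(j in V2) \sum_(j' in V2) \sum_(k in V3) \sum_(k' in V3)
     tri a (w j) (w k) * tri a' (w j') (w k').
pose F2 a a' b b' (w : {ffun I -> T}) :=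
  \sum_(k in V3) \sum_(k' in V3) tri a b (w k) * tri a' b' (w k').
have -> : avg (fun w => ntri w ^+ 2) =
    avg (fun w : {ffun I -> T} => \sum_(i in V1) \sum_(i' in V1) F1 (w i) (w i') w).
  apply: eq_avg => w; rewrite sqr_sum; apply: eq_bigr => i _; apply: eq_bigr => i' _.
  rewrite mulr_suml; apply: eq_bigr => j _; rewrite mulr_sumr; apply: eq_bigr => j' _.
  by rewrite mulr_suml; apply: eq_bigr => k _; rewrite mulr_sumr.
(* Number of ordered pairs of distinct vertices in a block. *)
set M : R := m%:R ^+ 2 - m%:R.
have E3 a a' b b' : avg (F2 a a' b b') =
    m%:R * avg (fun c => tri a b c * tri a' b' c) + M * (avg (tri a b) * avg (tri a' b')).
  rewrite (avg_pairs (V := V3) (F := fun c c' _ => tri a b c * tri a' b' c')) // c3.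
  congr (_ * _ + _ * _); first by apply: eq_avg => c; rewrite avgC.
  rewrite -avgZr; apply: eq_avg => c; rewrite -avgZ; apply: eq_avg => c'.
  by rewrite avgC.
have E2 a a' : avg (F1 a a') =
    m%:R * avg (fun b => avg (F2 a a' b b)) +
    M * avg (fun b => avg (fun b' => avg (F2 a a' b b'))).
  rewrite (avg_pairs (V := V2) (F := fun b b' w => F2 a a' b b' w)) ?c2 //.
  move=> j b b' w c jV; apply: eq_bigr => k kV; apply: eq_bigr => k' kV'.
  by rewrite !updateE // ?(neq_disjoint d23 jV).
rewrite (avg_pairs (V := V1) (F := F1)) ?c1 //; last first.
  move=> i a a' w c iV; apply: eq_bigr => j jV; apply: eq_bigr => j' jV'.
  apply: eq_bigr => k kV; apply: eq_bigr => k' kV'.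
  by rewrite !updateE ?(neq_disjoint d12 iV jV) ?(neq_disjoint d12 iV jV')
             ?(neq_disjoint d13 iV kV) ?(neq_disjoint d13 iV kV').
have regular' a : avg (fun b => avg (fun c => tri b c a)) = beta.
  rewrite -(regular a); apply: eq_avg => b; apply: eq_avg => c.
  by rewrite tri_swapr tri_swapl.
have regular2 a : avg (fun b => avg (tri b a)) = beta.
  by rewrite -(regular a); apply: eq_avg => b; apply: eq_avg => c; rewrite tri_swapl.
rewrite -/M.
(* The [V1] vertex is shared; the terms stand for two, one or no further common vertices. *)
have D a : avg (F1 a a) = m%:R ^+ 2 * beta +
   m%:R * M * avg (fun b => avg (tri a b) ^+ 2) * 2 + M ^+ 2 * beta ^+ 2.
  rewrite E2.
  have -> : avg (fun b => avg (F2 a a b b)) =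
     m%:R * beta + M * avg (fun b => avg (tri a b) ^+ 2).
    under eq_avg => b do rewrite E3 (eq_avg (triM a b)).
    by rewrite avgD !avgZ regular.
  have -> : avg (fun b => avg (fun b' => avg (F2 a a b b'))) =
     m%:R * avg (fun b => avg (tri a b) ^+ 2) + M * beta ^+ 2.
    under eq_avg => b do (under eq_avg => b' do rewrite E3;
       rewrite avgD !avgZ regular).
    rewrite avgD !avgZ avgZr regular -expr2; congr (_ * _ + _).
    (* Here the [V1] and [V3] vertices are shared: with [c] outside, [b] and [b'] are independent
       given [a] and [c], and symmetry turns this into the square for the pair [a], [c]. *)
    under eq_avg => b do rewrite exchange_avg.
    rewrite exchange_avg; apply: eq_avg => c.
    rewrite expr2 -avgZr; apply: eq_avg => b; rewrite avgZ tri_swapr.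
    by congr (_ * _); apply: eq_avg => b'; rewrite tri_swapr.
  by ring.
(* The [V1] vertices differ; again the terms stand for two, one or no common vertices, and only the
   first case is a shared edge. *)
have O : avg (fun a => avg (fun a' => avg (F1 a a'))) =
  m%:R ^+ 2 * shared_edge_prob + 2 * m%:R * M * beta ^+ 2 + M ^+ 2 * beta ^+ 2.
  have -> : avg (fun a => avg (fun a' => avg (F1 a a'))) =
     m%:R * avg (fun b => avg (fun a => avg (fun a' => avg (F2 a a' b b)))) +
     M * avg (fun a => avg (fun b => avg (fun a' => avg (fun b' => avg (F2 a a' b b'))))).
    under eq_avg => a do (under eq_avg => a' do rewrite E2; rewrite avgD !avgZ).
    rewrite avgD !avgZ; congr (_ * _ + _ * _).
      under eq_avg => a do rewrite exchange_avg.
      by rewrite exchange_avg.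
    by under eq_avg => a do rewrite exchange_avg.
  under eq_avg => b do (under eq_avg => a do (under eq_avg => a' do rewrite E3;
    rewrite avgD !avgZ regular2); rewrite avgD !avgZ avgZr regular2).
  rewrite avgD !avgZ avgC //.
  under [X in _ + M * X = _]eq_avg => a do (under eq_avg => b do (under eq_avg => a' do
    (under eq_avg => b' do rewrite E3; rewrite avgD !avgZ regular);
    rewrite avgD !avgZ avgC //); rewrite avgD !avgZ avgZr regular).
  rewrite avgD !avgZ avgC //.
  have -> : avg (fun b => avg (fun a => avg (fun a' => avg (fun c =>
       tri a b c * tri a' b c)))) = shared_edge_prob.
    apply: eq_avg => b.
    under eq_avg => a do rewrite exchange_avg.
    rewrite exchange_avg; apply: eq_avg => c; rewrite avgM expr2.
    by congr (_ * _); apply: eq_avg => a; rewrite tri_swapl tri_swapr.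
  have -> : avg (fun a => avg (fun b => avg (fun a' => avg (fun b' =>
       avg (fun c => tri a b c * tri a' b' c))))) = beta ^+ 2.
    rewrite -[RHS](avgC (beta ^+ 2) T0).
    under eq_avg => a do (under eq_avg => b do
      (under eq_avg => a' do rewrite exchange_avg; rewrite exchange_avg);
      rewrite exchange_avg).
    rewrite exchange_avg; apply: eq_avg => c.
    under eq_avg => a do (under eq_avg => b do
      (under eq_avg => a' do rewrite avgZ; rewrite avgZ regular'); rewrite avgZr).
    by rewrite avgZr regular' expr2.
  by ring.
under eq_avg => a do rewrite D.
rewrite O !avgD !avgC // avgZr avgZ -/shared_edge_prob.
have g0 : 0 <= shared_edge_prob.
  by apply: avg_ge0 => x; apply: avg_ge0 => y; apply: sqr_ge0.
have m0 : 0 <= m%:R :> R by exact: ler0n.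
have M0 : 0 <= M.
  by rewrite /M subr_ge0 -natrX ler_nat -mulnn; case: (m) => [|k] //; rewrite leq_pmulr.
(* [h1] and [h2] add up to the gap between the exact second moment and the bound, which replaces [M]
   by [m ^ 2] in the shared-edge term and counts all [m ^ 6] pairs in the [beta ^+ 2] term. *)
have h1 : 0 <= 3 * m%:R ^+ 3 * shared_edge_prob.
  by apply: mulr_ge0 => //; apply: mulr_ge0; rewrite ?exprn_ge0 ?ler0n.
have h2 : 0 <= (3 * M * m%:R ^+ 2 + m%:R ^+ 3) * beta ^+ 2.
  by rewrite mulr_ge0 ?sqr_ge0 ?addr_ge0 ?mulr_ge0 ?exprn_ge0 ?ler0n.
rewrite -subr_ge0; apply: le_trans (addr_ge0 h1 h2) _; rewrite le_eqVlt; apply/orP; left.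
by apply/eqP; rewrite /M; move: (shared_edge_prob) => g; ring.
Qed.

End Tripartite.

(** * Uniform key rings: avoidance, overlap and triangle probabilities *)

Lemma disjoint_setU (T : finType) (A B C : {set T}) :
  [disjoint A :|: B & C] = [disjoint A & C] && [disjoint B & C].
Proof. by rewrite -!setI_eq0 setIUl setU_eq0. Qed.

Section KeyRings.
Variables (R : realFieldType) (P K : nat).
Hypotheses (K0 : (0 < K)%N) (KP : (K <= P)%N).
Local Notation keys := (keyring P K).
Implicit Types x y z : keys.

(** Probability that a ring avoids [s] given keys; q is the case [s = K], and r the case
    [s = 2 * K]. *)
Definition disjoint_prob s : R := 'C(P - s, K)%:R / 'C(P, K)%:R.
Local Notation pdisj := disjoint_prob.

Lemma card_keyring_pred (p : pred {set 'I_P}) :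
  #|[pred z : keys | p (val z)]| = #|[set A | p A & #|A| == K]|.
Proof.
rewrite -(card_image val_inj); apply: eq_card => A; rewrite inE.
apply/imageP/andP => [[z pz ->]|[pA cA]]; first by split=> //; apply: (valP z).
by exists (Sub A cA : keys); rewrite ?inE SubK.
Qed.

Lemma card_keyring : #|{: keys}| = 'C(P, K).
Proof.
rewrite (eq_card (B := [pred z : keys | predT (val z)])) //.
rewrite card_keyring_pred /= -[in RHS](card_ord P) -(card_draws _ K).
by apply: eq_card => A; rewrite !inE.
Qed.

Lemma card_keyring_gt0 : (0 < #|{: keys}|)%N.
Proof. by rewrite card_keyring bin_gt0. Qed.
Local Hint Resolve card_keyring_gt0 : core.

Lemma avg_disjoint (A : {set 'I_P}) :
  avg (fun z => [disjoint A & val z]%:R : R) = pdisj #|A|.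
Proof.
rewrite (avg_card _ (fun z : keys => [disjoint A & val z])) card_keyring /disjoint_prob.
rewrite (card_keyring_pred (fun B => [disjoint A & B])).
have -> : (P - #|A|)%N = #|~: A| by rewrite [#|~: A|]cardsCs setCK card_ord.
rewrite -cards_draws; congr (_%:R / _); apply: eq_card => B.
by rewrite !inE disjoint_sym disjoints_subset.
Qed.

Definition hits x y := ~~ [disjoint val x & val y].
Local Notation hit x y := ((hits x y)%:R : R).

Lemma hits_sym : symmetric hits.
Proof. by move=> x y; rewrite /hits disjoint_sym. Qed.

Lemma natr_negb (b : bool) : (~~ b)%:R = 1 - b%:R :> R.
Proof. by case: b; rewrite ?subrr ?subr0. Qed.

Lemma avg_hit x : avg (fun y => hit x y) = 1 - pdisj K.
Proof.
under eq_avg => y do rewrite natr_negb.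
by rewrite avgD avgN avgC // avg_disjoint (eqP (valP x)).
Qed.

Lemma hitU x y z : hit x z * hit y z =
  1 - [disjoint val x & val z]%:R - [disjoint val y & val z]%:R
    + [disjoint val x :|: val y & val z]%:R.
Proof.
rewrite !natr_negb disjoint_setU.
by case: [disjoint _ & _]; case: [disjoint _ & _] => /=; ring.
Qed.

Lemma tri_hits x y z : tri R hits x y z = hit x y * (hit x z * hit y z).
Proof. by rewrite /tri; do 3 case: (hits _ _); rewrite ?(mulr0, mul0r, mulr1). Qed.

Lemma avg_hit2 x y :
  avg (fun z => hit x z * hit y z) = 1 - 2 * pdisj K + pdisj #|val x :|: val y|.
Proof.
under eq_avg => z do rewrite hitU.
by rewrite !avgD !avgN avgC // !avg_disjoint (eqP (valP x)) (eqP (valP y)); ring.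
Qed.

(** The expansion of (1 - q)^3 + q (q^2 - r). *)
Definition triangle_prob : R :=
  1 - 3 * pdisj K + 3 * pdisj K ^+ 2 - pdisj K * pdisj (2 * K).
Local Notation bet := triangle_prob.

Lemma avg_tri x : avg (fun y => avg (tri R hits x y)) = bet.
Proof.
rewrite /triangle_prob; have cx := eqP (valP x).
(* The factor [hit x y] removes exactly the disjoint pairs, whose union has [2 * K] keys. *)
have -> : avg (fun y => avg (tri R hits x y)) =
  avg (fun y => (1 - 2 * pdisj K) * hit x y + (pdisj #|val x :|: val y| -
      [disjoint val x & val y]%:R * pdisj (2 * K))).
  apply: eq_avg => y; under eq_avg => z do rewrite tri_hits.
  rewrite avgZ avg_hit2 natr_negb; have [d|_] := boolP [disjoint _ & _]; last first.
    by rewrite /=; ring.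
  by rewrite cardsU disjoint_setI0 // cards0 subn0 cx (eqP (valP y)) mul2n addnn /=; ring.
rewrite !avgD avgN avgZ avg_hit avgZr avg_disjoint cx.
(* A ring [z] must avoid both [x] and [y]; with [z] outside, [y] avoids it with probability q
   whatever [z] is. *)
have -> : avg (fun y => pdisj #|val x :|: val y|) = pdisj K ^+ 2.
  have -> : avg (fun y => pdisj #|val x :|: val y|) =
     avg (fun y => avg (fun z =>
       [disjoint val x & val z]%:R * [disjoint val z & val y]%:R)).
    apply: eq_avg => y; rewrite -avg_disjoint; apply: eq_avg => z.
    rewrite disjoint_setU [[disjoint val z & _]]disjoint_sym.
    by case: [disjoint _ & _]; rewrite ?mul1r ?mul0r.
  rewrite exchange_avg expr2.
  have {1}<- : avg (fun z => [disjoint val x & val z]%:R) = pdisj K.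
    by rewrite avg_disjoint cx.
  rewrite -avgZr.
  by apply: eq_avg => z; rewrite avgZ avg_disjoint (eqP (valP z)).
by ring.
Qed.

Definition key_density : R := K%:R / P%:R.
Local Notation kap := key_density.
Let P0 : P%:R != 0 :> R.
Proof. by rewrite pnatr_eq0 -lt0n (leq_trans K0). Qed.
Let C0 : 'C(P, K)%:R != 0 :> R.
Proof. by rewrite pnatr_eq0 -lt0n bin_gt0. Qed.

Lemma disjoint_prob1 : pdisj 1 = 1 - kap.
Proof.
rewrite /disjoint_prob /key_density subn1; apply: (mulIf C0); apply: (mulfI P0).
rewrite mulfVK // -natrM mul_bin_down natrM natrB //.
by move: (_%:R) C0 => c c0; field.
Qed.

Lemma key_density_ge0 : 0 <= kap. Proof. exact: divr_ge0. Qed.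

Lemma disjoint_prob_ge0 s : 0 <= pdisj s. Proof. exact: divr_ge0. Qed.

(** For [K < P], a ring missing one key misses a second with probability 1 - K/(P - 1), below 1 -
    K/P; for [K = P] no ring misses a key. *)
Lemma disjoint_prob2 : (2 <= P)%N -> pdisj 2 <= (1 - kap) ^+ 2.
Proof.
move=> P2; have [KeP|KltP] := eqVneq K P.
  rewrite {1}/disjoint_prob bin_small ?mul0r ?sqr_ge0 //.
  by rewrite -KeP -{2}(subn0 K) ltn_sub2l.
have {KltP} KltP : (K < P)%N by rewrite ltn_neqAle KltP.
have P1 : (0 : R) < P%:R - 1 by rewrite subr_gt0 ltr1n.
have -> : pdisj 2 = (1 - K%:R / (P%:R - 1)) * pdisj 1.
  rewrite /disjoint_prob mulrA; congr (_ / _).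
  have := mul_bin_down (P - 1) K.
  have P1n : (0 < P)%N by apply: leq_trans P2.
  have KP1 : (K <= P - 1)%N by rewrite -ltnS subn1 prednK.
  move=> /(congr1 (fun n => n%:R : R)); rewrite !natrM !natrB //.
  rewrite -subn1 -subnDA addn1 => h.
  apply: (mulfI (lt0r_neq0 P1)); rewrite h; move: ('C(_, _)%:R) => c.
  by field; rewrite lt0r_neq0.
rewrite disjoint_prob1 expr2; apply: ler_wpM2r.
  by rewrite -disjoint_prob1 disjoint_prob_ge0.
rewrite lerD2l lerN2 /key_density ler_wpM2l // lef_pV2 ?posrE ?P1 //; last by lra.
by lra.
Qed.

Lemma mem_disjoint a z : (a \in val z)%:R = 1 - [disjoint [set a] & val z]%:R :> R.
Proof. by rewrite disjoints1 natr_negb; ring. Qed.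

Lemma avg_mem (a : 'I_P) : avg (fun z => (a \in val z)%:R : R) = kap.
Proof.
under eq_avg => z do rewrite mem_disjoint.
by rewrite avgD avgN avgC // avg_disjoint cards1 disjoint_prob1; ring.
Qed.

(** Inclusion-exclusion carries the negative correlation over from missing two keys to containing
    them. *)
Lemma avg_mem2 (a b : 'I_P) : a != b ->
  avg (fun z => (a \in val z)%:R * (b \in val z)%:R : R) <= kap ^+ 2.
Proof.
move=> ab.
have -> : avg (fun z => (a \in val z)%:R * (b \in val z)%:R : R) =
   avg (fun z => 1 - [disjoint [set a] & val z]%:R - [disjoint [set b] & val z]%:R
         + [disjoint [set a; b] & val z]%:R).
  apply: eq_avg => z.
  rewrite disjoint_setU !disjoints1.
  by case: (a \in _); case: (b \in _) => /=; ring.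
rewrite !avgD !avgN avgC // !avg_disjoint !cards1 cards2 ab disjoint_prob1.
have P2 : (2 <= P)%N.
  by rewrite -[P]card_ord (leq_trans _ (max_card (mem [set a; b]))) // cards2 ab.
have := disjoint_prob2 P2; lra.
Qed.

(** K^2/P, the expected number of common keys of two rings. *)
Definition mean_overlap : R := K%:R * kap.
Local Notation lam := mean_overlap.

Lemma card_inter x y : #|val x :&: val y|%:R = \sum_(a in val x) (a \in val y)%:R :> R.
Proof.
rewrite -sum1_card natr_sum (eq_bigl (fun a => (a \in val x) && (a \in val y))).
  by rewrite big_mkcondr; apply: eq_bigr => a _; case: (a \in _).
by move=> a; rewrite inE.
Qed.

Lemma sum_key (x : keys) (c : R) : \sum_(a in val x) c = K%:R * c.
Proof. by rewrite sumr_const (eqP (valP x)) -[LHS]mulr_natl. Qed.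

Lemma hit_le_inter x y : hit x y <= #|val x :&: val y|%:R.
Proof. by rewrite ler_nat /hits -setI_eq0 -card_gt0; case: (#|_|). Qed.

Lemma avg_inter x : avg (fun y => #|val x :&: val y|%:R : R) = lam.
Proof.
under eq_avg => y do rewrite card_inter.
by rewrite avg_sum (eq_bigr (fun _ => kap)) ?sum_key // => a _; rewrite avg_mem.
Qed.

Lemma disjoint_prob_ge : 1 - lam <= pdisj K.
Proof.
have [x _] : exists x : keys, true by have /card_gt0P[x _] := card_keyring_gt0; exists x.
suff : 1 - pdisj K <= lam by lra.
by rewrite -(avg_hit x) -(avg_inter x); apply: ler_avg => y; apply: hit_le_inter.
Qed.

(** The square is a sum over pairs of keys: equal keys give [lam], distinct ones at most [lam ^+ 2]
    by negative correlation. *)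
Lemma avg_inter_sqr x : avg (fun y => #|val x :&: val y|%:R ^+ 2 : R) <= lam + lam ^+ 2.
Proof.
under eq_avg => y do rewrite card_inter sqr_sum.
rewrite avg_sum; have -> : lam + lam ^+ 2 = \sum_(a in val x) (kap + K%:R * kap ^+ 2).
  by rewrite sum_key /mean_overlap; ring.
apply: ler_sum => a ax; rewrite avg_sum (bigD1 a) //=; apply: lerD.
  by rewrite -(avg_mem a); apply: ler_avg => z; case: (a \in _); rewrite ?mulr1 ?mulr0.
rewrite -(sum_key x) [leRHS](bigD1 a) //= -[leLHS]add0r.
apply: lerD; first exact: sqr_ge0.
by apply: ler_sum => b /andP[_ ba]; apply: avg_mem2; rewrite eq_sym.
Qed.

(* A ring z meeting both x and y contains a common key of x and y, or two
   distinct keys, one of each. *)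
Lemma avg_hit2_le x y :
  avg (fun z => hit x z * hit y z) <= #|val x :&: val y|%:R * kap + lam ^+ 2.
Proof.
have -> : #|val x :&: val y|%:R * kap + lam ^+ 2 =
   \sum_(a in val x) ((a \in val y)%:R * kap + K%:R * kap ^+ 2).
  by rewrite big_split sum_key card_inter mulr_suml /mean_overlap; congr (_ + _); ring.
apply: (@le_trans _ _ (avg (fun z => \sum_(a in val x)
   ((a \in val y)%:R * (a \in val z)%:R +
    \sum_(b in val y | b != a) (a \in val z)%:R * (b \in val z)%:R)))).
  apply: ler_avg => z.
  have nn (a b : 'I_P) : 0 <= (a \in val z)%:R * (b \in val z)%:R :> R.
    by rewrite mulr_ge0.
  have s0 a : 0 <= \sum_(b in val y | b != a) (a \in val z)%:R * (b \in val z)%:R :> R.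
    by apply: sumr_ge0.
  have t0 a : 0 <= (a \in val y)%:R * (a \in val z)%:R +
     \sum_(b in val y | b != a) (a \in val z)%:R * (b \in val z)%:R :> R.
    by rewrite addr_ge0 ?mulr_ge0.
  rewrite /hits; have [_|/pred0Pn[a /andP[/= ax az]]] := boolP [disjoint val x & _].
    by rewrite mul0r; apply: sumr_ge0 => a _; apply: t0.
  have [_|/pred0Pn[b /andP[/= b_y bz]]] := boolP [disjoint val y & _].
    by rewrite mulr0; apply: sumr_ge0 => c _; apply: t0.
  rewrite mulr1 (bigD1 a) //= -[leLHS]addr0; apply: lerD; last by apply: sumr_ge0.
  have [aE|ba] := eqVneq b a.
    rewrite -[leLHS]addr0; apply: lerD; last exact: s0.
    by rewrite -{1}aE b_y az mulr1.
  rewrite (bigD1 b) ?b_y //= addrCA -[leLHS]addr0; apply: lerD.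
    by rewrite az bz mulr1.
  by rewrite addr_ge0 ?mulr_ge0 //; apply: sumr_ge0.
rewrite avg_sum; apply: ler_sum => a ax; rewrite avgD avgZ avg_mem; apply: lerD => //.
under eq_avg => z do rewrite big_mkcondr.
rewrite avg_sum -(sum_key y); apply: ler_sum => b b_y; have [ba|] := eqVneq b a.
  by rewrite avgC // sqr_ge0.
by move=> ba; apply: avg_mem2; rewrite eq_sym.
Qed.

Lemma mean_overlap_ge0 : 0 <= lam.
Proof. by rewrite mulr_ge0 // key_density_ge0. Qed.

Local Notation gam := (shared_edge_prob R hits).

(** For s common keys, [avg_hit2_le] bounds the squared completion probability by (s kap + lam^2)^2
    <= 2 s^2 kap^2 + 2 lam^4. An edge has s >= 1, so the last term may be multiplied by s; then the
    moments of the overlap apply. *)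
Lemma shared_edge_prob_le : gam <= 2 * kap ^+ 2 * (lam + lam ^+ 2) + 2 * lam ^+ 5.
Proof.
rewrite -[leRHS](avgC _ card_keyring_gt0); apply: ler_avg => x.
apply: (@le_trans _ _ (avg (fun y => 2 * kap ^+ 2 * #|val x :&: val y|%:R ^+ 2 +
    2 * lam ^+ 4 * #|val x :&: val y|%:R))).
  apply: ler_avg => y; under eq_avg => z do rewrite tri_hits.
  rewrite avgZ.
  have := hit_le_inter x y; have := avg_hit2_le x y.
  have : 0 <= avg (fun z => hit x z * hit y z).
    by apply: avg_ge0 => z; rewrite mulr_ge0.
  have := mean_overlap_ge0; have := key_density_ge0.
  set p := avg _; move: (#|_|%:R) => s.
  case: (hits x y) => k0 l0 p0 ps s1; rewrite /= ?mul1r ?mul0r; last first.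
    rewrite expr0n /=; apply: addr_ge0; apply: mulr_ge0 => //; try exact: sqr_ge0.
      by apply: mulr_ge0 => //; apply: sqr_ge0.
    by apply: mulr_ge0 => //; apply: exprn_ge0.
  have h : p ^+ 2 <= (s * kap + lam ^+ 2) ^+ 2.
    by rewrite lerXn2r ?nnegrE // (le_trans p0).
  apply: (le_trans h).
  have h2 : 0 <= (s * kap - lam ^+ 2) ^+ 2 by apply: sqr_ge0.
  have h3 : 0 <= lam ^+ 4 * (s - 1) by rewrite mulr_ge0 ?exprn_ge0 ?subr_ge0.
  nra.
rewrite avgD !avgZ avg_inter; apply: lerD.
  by rewrite ler_wpM2l ?avg_inter_sqr // mulr_ge0 ?sqr_ge0.
by rewrite -mulrA -exprSr.
Qed.

(** A probability dominates its square. *)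
Lemma shared_edge_prob_le_triangle : gam <= bet.
Proof.
rewrite -[leRHS](avgC _ card_keyring_gt0); apply: ler_avg => x.
rewrite -(avg_tri x); apply: ler_avg => y.
have p0 : 0 <= avg (tri R hits x y) by apply: avg_ge0 => z; apply: tri_ge0.
rewrite expr2 ler_piMr // -[leRHS](avgC _ card_keyring_gt0); apply: ler_avg => z.
by rewrite /tri; case: [&& _, _ & _].
Qed.

End KeyRings.

(** * Explicit bounds on q, r, the triangle probability and the shared-edge probability *)

Ltac nonneg := by repeat first
  [ assumption | exact: sqr_ge0 | exact: ler0n | exact: ler01 | rewrite subr_ge0
  | apply: addr_ge0 | apply: mulr_ge0 | apply: exprn_ge0 ].

Section Bounds.
Variables (R : realFieldType) (P K : nat).
Hypotheses (K0 : (0 < K)%N) (KP : (K <= P)%N).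
Local Notation kap := (key_density R P K).
Local Notation lam := (mean_overlap R P K).
Local Notation pdisj := (disjoint_prob R P K).
Local Notation bet := (triangle_prob R P K).
Local Notation gam := (shared_edge_prob R (@hits P K)).

Lemma key_densityE : kap * P%:R = K%:R.
Proof. by rewrite /key_density mulfVK // pnatr_eq0 -lt0n (leq_trans K0). Qed.

Lemma disjoint_probE s : pdisj s * (P ^_ K)%:R = ((P - s) ^_ K)%:R.
Proof.
rewrite /disjoint_prob -!bin_ffact !natrM mulrA mulfVK //.
by rewrite pnatr_eq0 -lt0n bin_gt0.
Qed.

Lemma ffact_neq0 : (P ^_ K)%:R != 0 :> R.
Proof. by rewrite pnatr_eq0 -lt0n ffact_gt0. Qed.

(** Each factor shrinks by a ratio of at most 1 - kap <= 1/(1 + kap), and the induction contains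
    Bernoulli's inequality. The case [k = K] gives q (1 + lam) <= 1. *)
Lemma ffact_sub_le k : ((P - K) ^_ k)%:R * (1 + k%:R * kap) <= (P ^_ k)%:R.
Proof.
elim: k => [|k IH]; first by rewrite !ffactn0 mul0r addr0 mulr1.
rewrite !ffactnSr.
(* From [k = P - K] on, the new factor is a truncated difference equal to 0. *)
have [Pk|kP] := leqP (P - K) k.
  by rewrite (eqP (_ : P - K - k == 0)%N) ?muln0 ?mul0r.
have kP' : (k <= P)%N by rewrite (leq_trans (ltnW kP)) // leq_subr.
rewrite !natrM (natrB _ (ltnW kP)) !natrB //.
have := key_densityE; have := key_density_ge0 R P K; move: IH.
have := ler0n R k; have := ler0n R ((P - K) ^_ k); have := ler0n R K.
have : k%:R <= P%:R :> R by rewrite ler_nat.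
rewrite -[k.+1%:R]natr1; move: (kap) (k%:R : R) (P%:R : R) (K%:R : R)
  (((P - K) ^_ k)%:R : R) ((P ^_ k)%:R : R) => x i p j a b.
move=> ip j0 a0 i0 IH x0 E.
have h1 : 0 <= (b - a * (1 + i * x)) * (p - i) by nonneg.
have h2 : 0 <= a * (i * x * j + x * j + x * i) by nonneg.
rewrite -subr_ge0; suff -> : b * (p - i) - a * (p - j - i) * (1 + (i + 1) * x) =
  (b - a * (1 + i * x)) * (p - i) + a * (i * x * j + x * j + x * i) by rewrite addr_ge0.
by rewrite -E; ring.
Qed.

(** As (P - 2K - i)(P - i) = (P - K - i)^2 - K^2, each factor gains at least 1 + kap^2. For [k = K]
    this sharpens r <= q^2 by the term K kap^2 = K^3/P^2 of tau. *)
Lemma ffact_log_concave k :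
  ((P - 2 * K) ^_ k)%:R * (P ^_ k)%:R * (1 + k%:R * kap ^+ 2) <=
  ((P - K) ^_ k)%:R ^+ 2.
Proof.
elim: k => [|k IH]; first by rewrite !ffactn0 mul0r addr0 !mulr1 expr1n.
rewrite !ffactnSr.
have [Pk|kP] := leqP (P - 2 * K) k.
  by rewrite (eqP (_ : P - 2 * K - k == 0)%N) ?muln0 ?mul0r ?sqr_ge0.
have K2P : (2 * K <= P)%N by rewrite ltnW // -subn_gt0 (leq_trans _ kP).
have kP1 : (k <= P - K)%N.
  by rewrite (leq_trans (ltnW kP)) // leq_sub2l // mul2n -addnn leq_addr.
have kP' : (k <= P)%N by rewrite (leq_trans kP1) // leq_subr.
rewrite !natrM (natrB _ (ltnW kP)) (natrB _ kP1) !natrB // natrM.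
have := key_densityE; have := key_density_ge0 R P K; move: IH.
have := ler0n R k; have := ler0n R ((P - K) ^_ k); have := ler0n R K.
have := ler0n R ((P - 2 * K) ^_ k).
have := ler0n R (P ^_ k).
have : 0 <= P%:R - K%:R - k%:R :> R by rewrite -!natrB.
rewrite -[k.+1%:R]natr1.
move: (kap) (k%:R : R) (P%:R : R) (K%:R : R)
  (((P - 2 * K) ^_ k)%:R : R) ((P ^_ k)%:R : R) (((P - K) ^_ k)%:R : R) => x i p j a b c.
move=> M0 b0 a0 j0 c0 i0 IH x0 E.
have := mulr_ge0 a0 b0; move: IH M0; set u := a * b; set M := p - j - i => IH M0 u0.
have Mp : M ^+ 2 <= p ^+ 2.
  have Mp : M <= p by rewrite /M; lra.
  by rewrite lerXn2r ?nnegrE // (le_trans M0).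
have h1 : 0 <= (c ^+ 2 - u * (1 + i * x ^+ 2)) * M ^+ 2.
  by nonneg.
have h2 : 0 <= u * x ^+ 2 * (p ^+ 2 - M ^+ 2).
  by nonneg.
have h3 : 0 <= u * (j ^+ 2 * ((i + 1) * x ^+ 2)).
  by nonneg.
rewrite -subr_ge0; apply: le_trans (addr_ge0 (addr_ge0 h1 h2) h3) _.
by rewrite le_eqVlt; apply/orP; left; apply/eqP; rewrite /M /u -E; ring.
Qed.

Lemma disjoint_prob_le : pdisj K * (1 + lam) <= 1.
Proof.
have F : 0 < (P ^_ K)%:R :> R by rewrite lt0r ffact_neq0 ler0n.
rewrite -(ler_pM2r F) mul1r mulrAC disjoint_probE.
exact: ffact_sub_le.
Qed.

Lemma disjoint_prob_log_concave : pdisj (2 * K) * (1 + K%:R * kap ^+ 2) <= pdisj K ^+ 2.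
Proof.
have F : 0 < (P ^_ K)%:R ^+ 2 :> R by rewrite exprn_gt0 // lt0r ffact_neq0 ler0n.
rewrite -(ler_pM2r F) -exprMn disjoint_probE; apply: le_trans (ffact_log_concave K).
by rewrite -(disjoint_probE (2 * K)) le_eqVlt; apply/orP; left; apply/eqP; ring.
Qed.

Lemma density_sqr_ge0 : 0 <= K%:R * kap ^+ 2.
Proof. by rewrite mulr_ge0 ?sqr_ge0. Qed.

Lemma triangle_prob_ge_cube : (1 - pdisj K) ^+ 3 <= bet.
Proof.
have := disjoint_prob_log_concave; have := density_sqr_ge0.
have := disjoint_prob_ge0 R P K (2 * K); have := disjoint_prob_ge0 R P K K.
rewrite /triangle_prob; move: (pdisj K) (pdisj (2 * K)) (_ * _) => q r a q0 r0 a0 h.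
have h1 : 0 <= q * (q ^+ 2 - r * (1 + a) + r * a) by nonneg.
by nra.
Qed.

(** The two summands of b match those of tau: (1 - q)^3 yields lam^3 through 1 - q >= 2 lam/3, and q
    (q^2 - r) yields K^3/P^2. *)
Lemma triangle_prob_ge : lam <= 1 / 2 -> K%:R * kap ^+ 2 + lam ^+ 3 <= 16 * bet.
Proof.
move=> lam2.
have kl : kap <= lam by rewrite /mean_overlap ler_peMl ?key_density_ge0 // ler1n.
have := disjoint_prob_log_concave; have := density_sqr_ge0; have := disjoint_prob_le.
have := disjoint_prob_ge R K0 KP.
have aE : K%:R * kap ^+ 2 = lam * kap by rewrite /mean_overlap; ring.
have := disjoint_prob_ge0 R P K (2 * K); have := disjoint_prob_ge0 R P K K.
rewrite aE; have := mean_overlap_ge0 R P K; have := key_density_ge0 R P K.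
move: kl lam2; rewrite /triangle_prob.
move: (pdisj K) (pdisj (2 * K)) (kap) (lam) => q r k l kl l2 k0 l0 q0 r0 q1 q2 a0 h.
have a1 : l * k <= 1 / 4 by nra.
have q12 : 1 / 2 <= q by lra.
have p1 : 2 / 3 * l <= 1 - q by nra.
have p3 : (2 / 3 * l) ^+ 3 <= (1 - q) ^+ 3 by rewrite lerXn2r ?nnegrE //; lra.
have ra : r * (l * k) <= r * (1 / 4) by rewrite ler_wpM2l.
have qa : 1 / 4 <= q ^+ 2 by nra.
(* From r (1 + lk) <= q^2 follows (q^2 - r)(1 + lk) >= q^2 lk >= lk/4, while 1 + lk <= 2. *)
have h4 : (l * k) / 8 <= q ^+ 2 - r.
  have : (l * k) / 8 * (1 + l * k) <= (q ^+ 2 - r) * (1 + l * k).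
    have := mulr_ge0 a0 (_ : 0 <= q ^+ 2 - 1 / 4); rewrite subr_ge0 => /(_ qa).
    nra.
  by rewrite ler_pM2r //; lra.
have h5 : (l * k) / 16 <= q * (q ^+ 2 - r) by nra.
have l3 : 0 <= l ^+ 3 by rewrite exprn_ge0.
nra.
Qed.

(** Multiplied by lam, the bound on g is at most 3 (lam kap)^2 + 2 lam^6, hence at most 4 tau^2; tau
    <= 16 b then gives 4 * 256 = 1024. *)
Lemma shared_edge_prob_le_sqr : lam <= 1 / 2 -> gam * lam <= 1024 * bet ^+ 2.
Proof.
move=> lam2; have := triangle_prob_ge lam2; have := shared_edge_prob_le R K0 KP.
have aE : K%:R * kap ^+ 2 = lam * kap by rewrite /mean_overlap; ring.
rewrite aE; have := mean_overlap_ge0 R P K; have := key_density_ge0 R P K.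
move: (gam) (bet) lam2; move: (kap) (lam) => k l g b l2 k0 l0 hg hb.
have a0 : 0 <= l * k by rewrite mulr_ge0.
have l3 : 0 <= l ^+ 3 by rewrite exprn_ge0.
have h1 : (l * k + l ^+ 3) ^+ 2 <= (16 * b) ^+ 2 by rewrite lerXn2r ?nnegrE //; lra.
have h2 : g * l <= (2 * k ^+ 2 * (l + l ^+ 2) + 2 * l ^+ 5) * l by rewrite ler_wpM2r.
have h3 : 0 <= k ^+ 2 * l ^+ 2 * (1 / 2 - l) by nonneg.
have h4 : 0 <= (l * k) * l ^+ 3 by rewrite mulr_ge0.
have h5 : 0 <= (l * k) ^+ 2 by rewrite sqr_ge0.
have h6 : 0 <= (l ^+ 3) ^+ 2 by rewrite sqr_ge0.
apply: (le_trans h2); nra.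
Qed.

End Bounds.

(** * Blocks of vertices *)

Lemma card_interval_ord n a b : (a <= b)%N -> (b <= n)%N ->
  #|[set i : 'I_n | (a <= i < b)%N]| = (b - a)%N.
Proof.
move=> ab bn; rewrite -sum1dep_card.
rewrite -(big_mkord (fun i => a <= i < b)%N (fun _ => 1%N)).
rewrite -[RHS]muln1 -sum_nat_const_nat [RHS](big_nat_widen _ _ n) //
  [RHS](big_nat_widenl _ 0) //.
by apply: eq_bigl => i; rewrite andbC.
Qed.

(** Blocks are consecutive intervals because [triangles] counts increasing triples only. *)
Definition block n m l : {set 'I_n} := [set i : 'I_n | (l * m <= i < l.+1 * m)%N].

Lemma card_block n m l : (l.+1 * m <= n)%N -> #|block n m l| = m.
Proof.
by move=> h; rewrite card_interval_ord // ?mulSn ?leq_addl // addnK.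
Qed.

Lemma block_lt n m l l' (i j : 'I_n) :
  (l < l')%N -> i \in block n m l -> j \in block n m l' -> (i < j)%N.
Proof.
rewrite !inE => ll /andP[_ i2] /andP[j1 _]; apply: leq_trans i2 _.
by apply: leq_trans j1; rewrite leq_mul2r ll orbT.
Qed.

Lemma block_disjoint n m l l' : (l < l')%N -> [disjoint block n m l & block n m l'].
Proof.
move=> ll; apply/pred0P => i /=; apply/andP => -[i1 i2].
by have := block_lt ll i1 i2; rewrite ltnn.
Qed.

(** * The second moment bound for the random key graph *)

Section Probability.
Variables (R : realFieldType) (n P K : nat).
Hypotheses (K0 : (0 < K)%N) (KP : (K <= P)%N).
Local Notation bet := (triangle_prob R P K).
Local Notation gam := (shared_edge_prob R (@hits P K)).

Definition no_triangle_prob : R := avg (fun w : outcome n P K => (triangles w == 0)%:R).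
Local Notation pfree := no_triangle_prob.

Lemma ntri_eq0 m (w : outcome n P K) : triangles w = 0%N ->
  ntri R (@hits P K) (block n m 0) (block n m 1) (block n m 2) w = 0.
Proof.
move=> /eqP; rewrite /triangles cards_eq0 => /eqP T0; rewrite /ntri.
rewrite big1 // => i iV; rewrite big1 // => j jV; rewrite big1 // => k kV.
have ij := block_lt (ltnSn 0) iV jV; have jk := block_lt (ltnSn 1) jV kV.
have := in_set0 ((i, j), k); rewrite -T0 inE /= ij jk /rkg_adj.
rewrite -!(inj_eq val_inj) /= !ltn_eqF ?(ltn_trans ij jk) //= /tri /hits.
by case: [&& _, _ & _].
Qed.

(** Chebyshev's inequality for the tripartite count, which vanishes on triangle-free outcomes,
    divided by [m ^ 3]. *)
Lemma no_triangle_prob_le m : (3 * m <= n)%N -> (0 < m)%N ->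
  pfree * m%:R ^+ 3 * bet ^+ 2 <= bet + 3 * m%:R * gam.
Proof.
move=> mn m0.
have T0 := card_keyring_gt0 KP.
have W0 : (0 < #|outcome n P K|)%N by rewrite card_ffun expn_gt0 T0.
have d01 := @block_disjoint n m 0 1 isT.
have d02 := @block_disjoint n m 0 2 isT.
have d12 := @block_disjoint n m 1 2 isT.
have c0 : #|block n m 0| = m.
  by apply: card_block; rewrite (leq_trans _ mn) // leq_mul2r orbT.
have c1 : #|block n m 1| = m.
  by apply: card_block; rewrite (leq_trans _ mn) // leq_mul2r orbT.
have c2 : #|block n m 2| = m by apply: card_block.
have reg := avg_tri R KP.
have E1 := avg_ntri T0 reg d01 d02 d12 c0 c1 c2.
have E2 := avg_ntri_sqr (@hits_sym P K) T0 reg d01 d02 d12 c0 c1 c2.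
have := chebyshev0 W0 E1 => /le_trans /(_ (lerB E2 (lexx _))).
move=> h.
have mp : (0 : R) < m%:R ^+ 3 by rewrite exprn_gt0 // ltr0n.
rewrite -(ler_pM2r mp); move: h; set X := avg _ => h.
have pX : pfree <= X.
  apply: ler_avg => w; have [T00|_] := eqVneq (triangles w) 0%N; last exact: ler0n.
  by rewrite ntri_eq0 // eqxx.
have h2 : pfree * (m%:R ^+ 3 * bet) ^+ 2 <= X * (m%:R ^+ 3 * bet) ^+ 2.
  by rewrite ler_wpM2r ?sqr_ge0.
have := le_trans h2 h.
move: pfree (m%:R) bet gam => p x b g hh.
nra.
Qed.

End Probability.

(** * Decay of the triangle-free probability in terms of n *)

Section Rates.
Variables (R : realFieldType) (n P K : nat).
Hypotheses (n3 : (3 <= n)%N) (K0 : (0 < K)%N) (KP : (K <= P)%N).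
Local Notation kap := (key_density R P K).
Local Notation lam := (mean_overlap R P K).
Local Notation bet := (triangle_prob R P K).
Local Notation gam := (shared_edge_prob R (@hits P K)).
Local Notation p := (no_triangle_prob R n P K).
Let m := (n %/ 3)%N.

Let m1 : (1 : R) <= m%:R.
Proof. by rewrite ler1n divn_gt0. Qed.

(** The remainder of [n] modulo 3 is at most 2, hence at most [2 * m]. *)
Let nm : n%:R <= 5 * m%:R :> R.
Proof.
have m0 : (0 < m)%N by rewrite divn_gt0.
rewrite -natrM ler_nat {1}(divn_eq n 3) -/m (mulnDl 3 2) mulnC leq_add2l.
by rewrite (@leq_trans 2) ?leq_pmulr // -ltnS ltn_mod.
Qed.

Let pm : p * m%:R ^+ 3 * bet ^+ 2 <= bet + 3 * m%:R * gam.
Proof. by apply: no_triangle_prob_le; rewrite ?divn_gt0 // mulnC leq_trunc_div. Qed.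

Lemma no_triangle_prob_ge0 : 0 <= p.
Proof. by apply: avg_ge0 => w; apply: ler0n. Qed.

(** With g <= b the second moment bound becomes p m^2 b <= 4, and n c^3 <= 5 m b <= 5 m^2 b. *)
Lemma no_triangle_prob_dense (c : R) : 0 < c -> disjoint_prob R P K K <= 1 - c ->
  p * (n%:R * c ^+ 3) <= 20.
Proof.
move=> c0 qc.
have bc : c ^+ 3 <= bet.
  apply: le_trans (triangle_prob_ge_cube R K0 KP).
  by rewrite lerXn2r ?nnegrE //; lra.
have := pm; have := shared_edge_prob_le_triangle R KP.
have := no_triangle_prob_ge0; have := ler0n R n.
have c3 : 0 < c ^+ 3 by rewrite exprn_gt0.
move: m1 nm bc; move: p (m%:R) (n%:R : R) bet gam (c ^+ 3) c3.
move=> x y z b g d d0 y1 zy db z0 x0 gb h.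
have b0 : 0 < b by apply: lt_le_trans db.
have h1 : x * y ^+ 3 * b ^+ 2 <= 4 * (y * b) by nra.
have yb : 0 < y * b by rewrite mulr_gt0 //; lra.
have h2 : x * y ^+ 2 * b <= 4.
  rewrite -(ler_pM2r yb); apply: le_trans h1.
  by rewrite le_eqVlt; apply/orP; left; apply/eqP; ring.
have h3 : z * d <= 5 * (y ^+ 2 * b).
  have : z * d <= 5 * y * b by rewrite ler_pM // ltW.
  have : 0 <= (y - 1) * (y * b) by rewrite mulr_ge0 ?subr_ge0 // ltW.
  by lra.
have := ler_wpM2l x0 h3; lra.
Qed.

(** A division-free form of p <= C (1/S + 1/L), where S is n^3 tau and L is n^2 lam. *)
Lemma no_triangle_prob_sparse : lam <= 1 / 2 ->
  let S := n%:R ^+ 3 * (K%:R * kap ^+ 2 + lam ^+ 3) in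
  let L := n%:R ^+ 2 * lam in p * (S * L) <= 256 * 300 * (L + S).
Proof.
move=> l2 /=.
have := triangle_prob_ge K0 KP l2; have := shared_edge_prob_le_sqr K0 KP l2.
have := pm; have := no_triangle_prob_ge0.
have l0 : 0 < lam.
  by rewrite /mean_overlap /key_density !mulr_gt0 ?invr_gt0 ?ltr0n // (leq_trans K0).
have a0 : 0 <= K%:R * kap ^+ 2 by rewrite mulr_ge0 ?sqr_ge0.
have l3 : 0 < lam ^+ 3 by rewrite exprn_gt0.
have n0 := ler0n R n.
move: m1 nm l0 a0 l3 n0.
move: p (m%:R) (n%:R : R) bet gam (lam) (K%:R * kap ^+ 2).
move=> x y z t g l a y1 zy l0 a0 l3 z0 x0 h gl st.
have t0 : 0 < t by lra.
have y0 : 0 < y by lra.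
(* Multiplying by lam brings in g lam <= 1024 b^2, and one factor b cancels; 3072 is 3 * 1024. *)
have H : x * y ^+ 3 * t * l <= l + 3072 * y * t.
  rewrite -(ler_pM2r t0).
  have h1 : (x * y ^+ 3 * t ^+ 2) * l <= (t + 3 * y * g) * l by rewrite ler_pM2r.
  have h2 : y * (g * l) <= y * (1024 * t ^+ 2) by rewrite ler_pM2l.
  by lra.
set S := z ^+ 3 * _; set L := z ^+ 2 * l.
have T0 : 0 < y ^+ 3 * t by rewrite mulr_gt0 ?exprn_gt0.
have W0 : 0 < y ^+ 2 * l by rewrite mulr_gt0 ?exprn_gt0.
have S0 : 0 <= S by rewrite mulr_ge0 ?exprn_ge0 //; lra.
have L0 : 0 <= L by rewrite mulr_ge0 ?exprn_ge0 //; lra.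
(* The factor 2000 is 5^3 * 16; below, 3072 * 5^2 = 256 * 300 gives the final constant. *)
have ST : S <= 2000 * (y ^+ 3 * t).
  have z3 : z ^+ 3 <= (5 * y) ^+ 3 by rewrite lerXn2r ?nnegrE //; lra.
  have := ler_pM (exprn_ge0 3 z0) (addr_ge0 a0 (ltW l3)) z3 st; rewrite /S; lra.
have LW : L <= 25 * (y ^+ 2 * l).
  have z2 : z ^+ 2 <= (5 * y) ^+ 2 by rewrite lerXn2r ?nnegrE //; lra.
  have := ler_wpM2r (ltW l0) z2; rewrite /L; lra.
have XTW : x * (y ^+ 3 * t) * (y ^+ 2 * l) <= y ^+ 2 * l + 3072 * (y ^+ 3 * t).
  by have := ler_wpM2l (exprn_ge0 2 (ltW y0)) H; lra.
move: (y ^+ 3 * t) (y ^+ 2 * l) S L T0 W0 S0 L0 ST LW XTW.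
move=> T W S L T0 W0 S0 L0 ST LW XTW.
rewrite -(ler_pM2r (mulr_gt0 T0 W0)).
have h1 := ler_wpM2l (mulr_ge0 S0 L0) XTW.
have h2 := ler_wpM2r (mulr_ge0 L0 (ltW W0)) ST.
have h3 := ler_wpM2r (mulr_ge0 S0 (ltW T0)) LW.
have h4 := mulr_ge0 L0 (ltW (mulr_gt0 T0 W0)).
lra.
Qed.

(** Since kap <= lam <= 1/2, tau is at most 2 lam^2, and n^3 <= n^4. *)
Lemma sparse_scales : lam <= 1 / 2 ->
  n%:R ^+ 3 * (K%:R * kap ^+ 2 + lam ^+ 3) <= 2 * (n%:R ^+ 2 * lam) ^+ 2.
Proof.
have kl : kap <= lam by rewrite /mean_overlap ler_peMl ?key_density_ge0 // ler1n.
have aE : K%:R * kap ^+ 2 = lam * kap by rewrite /mean_overlap; ring.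
have n1 : (1 : R) <= n%:R by rewrite ler1n (leq_trans _ n3).
rewrite aE; have := key_density_ge0 R P K; have := mean_overlap_ge0 R P K.
move: (n%:R : R) (kap) (lam) n1 kl => z k l z1 kl l0 k0 l2.
have h1 : l * k + l ^+ 3 <= 2 * l ^+ 2 by nra.
have h2 : z ^+ 3 <= z ^+ 4 by apply: ler_weXn2l.
have h3 : z ^+ 3 * (l * k + l ^+ 3) <= z ^+ 4 * (2 * l ^+ 2).
  rewrite ler_pM //; first by rewrite exprn_ge0 //; lra.
  by rewrite addr_ge0 ?mulr_ge0 ?exprn_ge0.
lra.
Qed.
End Rates.

(** * Translation to the real-valued statement, and the limit *)

Lemma qthetaE (K P : nat) : (0 < K)%N -> (K <= P)%N -> qtheta K P = disjoint_prob R P K K.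
Proof.
move=> K0 KP; rewrite /qtheta /disjoint_prob; have [_|PK] := leqP (2 * K) P.
  by rewrite RdivE !INRE.
(* For [P < 2 * K] the binomial 'C(P - K, K) is 0, in agreement with the default value of
   [qtheta]. *)
by rewrite bin_small ?mul0r // ltn_subLR // addnn -mul2n.
Qed.

Lemma tauthetaE (K P : nat) : (0 < K)%N -> (K <= P)%N ->
  tautheta K P = K%:R * key_density R P K ^+ 2 + mean_overlap R P K ^+ 3.
Proof.
move=> K0 KP; rewrite /tautheta !(RplusE, RdivE, RpowE, INRE) /mean_overlap /key_density.
have P0 : P%:R != 0 :> R by rewrite pnatr_eq0 -lt0n (leq_trans K0).
by field.
Qed.

Lemma prob_triangleE n (P K : nat) : (K <= P)%N ->
  prob_triangle n P K = 1 - no_triangle_prob R n P K.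
Proof.
move=> KP; have W0 : (0 < #|outcome n P K|)%N.
  by rewrite card_ffun expn_gt0 card_keyring_gt0.
have <- : avg (fun w : outcome n P K => (0 < triangles w)%N%:R) +
    no_triangle_prob R n P K = 1.
  rewrite -avgD (eq_avg (g := fun _ => 1)) ?avgC // => w.
  by rewrite lt0n natr_negb subrK.
by rewrite addrK (avg_card _ (fun w : outcome n P K => (0 < triangles w)%N))
  /prob_triangle RdivE !INRE cardsE.
Qed.

Lemma cvg_prob_triangle (P K : nat -> nat) :
  (forall n, (K n <= P n)%N) ->
  (forall eps : R, 0 < eps -> exists N : nat, forall n : nat, (N <= n)%N ->
     no_triangle_prob R n (P n) (K n) < eps) ->
  Un_cv (fun n => prob_triangle n (P n) (K n)) R1.
Proof.
move=> KP h eps /RltP eps0; have [N hN] := h eps eps0.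
exists N => n /ssrnat.leP Nn; rewrite prob_triangleE // RdistE; apply/RltP.
by rewrite -[R1]/(GRing.one R) addrAC subrr sub0r normrN ger0_norm ?hN //
  no_triangle_prob_ge0.
Qed.

Theorem theorem2 (P K : nat -> nat)
  (hscal : forall n : nat, (1 <= K n)%N /\ (K n <= P n)%N)
  (qstar : R)
  (hq : Un_cv (fun n => qtheta (K n) (P n)) qstar) :
  ((Rle R0 qstar /\ Rlt qstar R1) \/
   (qstar = R1 /\ cv_infty (fun n => Rmult (pow (INR n) 3) (tautheta (K n) (P n))))) ->
  Un_cv (fun n => prob_triangle n (P n) (K n)) R1.
Proof.
have K0 n : (0 < K n)%N by case: (hscal n).
have KP n : (K n <= P n)%N by case: (hscal n).
have hq' (c : R) : 0 < c -> exists N : nat, forall n, (N <= n)%N ->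
    `|disjoint_prob R (P n) (K n) (K n) - qstar| < c.
  move=> /RltP /hq[N hN]; exists N => n /ssrnat.leP Nn.
  by have /RltP := hN n Nn; rewrite RdistE qthetaE.
move=> hcase; apply: cvg_prob_triangle => // eps eps0.
case: hcase => [[_ /RltP q1]|[q1 htau]].
  (* Half the distance from the limit to 1, so that q <= 1 - c eventually. *)
  pose c := (1 - qstar) / 2.
  have c0 : 0 < c by rewrite divr_gt0 // subr_gt0.
  have [N1 h1] := hq' c c0.
  pose B := 20 / (eps * c ^+ 3).
  have [N2 /RltP] := INR_unbounded B.
  rewrite INRE => h2.
  exists (maxn 3 (maxn N1 N2)) => n; rewrite !geq_max => /and3P[n3 n1 n2].
  have qc : disjoint_prob R (P n) (K n) (K n) <= 1 - c.
    by have := h1 n n1; rewrite ltr_distl /c => /andP[_ ?]; lra.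
  have := no_triangle_prob_dense n3 (K0 n) (KP n) c0 qc.
  have c3 : 0 < eps * c ^+ 3 by rewrite mulr_gt0 ?exprn_gt0.
  have {}h2 : 20 < n%:R * (eps * c ^+ 3).
    by rewrite -ltr_pdivrMr //; apply: lt_le_trans h2 _; rewrite ler_nat.
  rewrite ltNge => h; apply/negP => pe.
  have : eps * (n%:R * c ^+ 3) <= 20.
    by apply: le_trans h; rewrite ler_wpM2r // mulr_ge0 ?exprn_ge0 // ltW.
  lra.
(* Eventually q > 2/3, and q (1 + lam) <= 1 then forces lam <= 1/2. *)
have [N1 h1] := hq' (1 / 3) ltac:(lra).
have C0 := @mulr_gt0 R 256 300 (ltr0n _ _) (ltr0n _ _).
(* If S and L both exceed [B], then C (L + S) < eps S L with C = 256 * 300. The bound [M] on S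
   ensures both: S > [B] directly, and L > [B] because 2 B^2 < S <= 2 L^2. *)
pose B := 2 * (256 * 300) / eps; pose M := B + 2 * B ^+ 2.
have B0 : 0 < B by rewrite divr_gt0 // mulr_gt0.
have [N2 h2] := htau M.
exists (maxn 3 (maxn N1 N2)) => n; rewrite !geq_max => /and3P[n3 n1 n2].
have {h2}/RltP := h2 n (elimT ssrnat.leP n2).
rewrite tauthetaE // RmultE RpowE INRE.
have l2 : mean_overlap R (P n) (K n) <= 1 / 2.
  have := disjoint_prob_le R (K0 n) (KP n); have := mean_overlap_ge0 R (P n) (K n).
  have := h1 n n1; rewrite q1 -[R1]/(GRing.one R) ltr_distl => /andP[].
  move: (disjoint_prob _ _ _ _) (mean_overlap _ _ _) => q l; nra.
have := sparse_scales n3 (K0 n) l2.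
have := no_triangle_prob_sparse n3 (K0 n) (KP n) l2 => /=.
have := mean_overlap_ge0 R (P n) (K n); have := ler0n R n.
set S := _ ^+ 3 * _ => z0 l0; set L := _ ^+ 2 * _.
have L0 : 0 <= L by rewrite mulr_ge0 ?exprn_ge0.
move=> h SL hS.
have BB : 0 <= 2 * B ^+ 2 by rewrite mulr_ge0 ?sqr_ge0.
have LB : B < L.
  rewrite ltNge; apply/negP => LB.
  have : L ^+ 2 <= B ^+ 2 by rewrite lerXn2r ?nnegrE // ltW.
  by move: hS; rewrite /M; lra.
have SB : B < S by rewrite (le_lt_trans _ hS) // lerDl.
have S0 : 0 < S by lra.
have {}L0 : 0 < L by lra.
rewrite ltNge; apply/negP => pe.
have := le_trans (ler_wpM2r (mulr_ge0 (ltW S0) (ltW L0)) pe) h.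
move: SB LB; rewrite /B !ltr_pdivrMr //; move: (256 * 300) C0 => C C0 SC LC.
have := ltr_pM2r L0 (2 * C) (S * eps); rewrite SC => k1.
have := ltr_pM2r S0 (2 * C) (L * eps); rewrite LC => k2.
lra.
Qed.
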